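(* For every integer $k\geq 2$ we have $\mathcal{TC}(\mathrm{SLT}_k)=\mathrm{CS}$, and moreover $\mathcal{TC}(\mathrm{SLT})=\mathrm{CS}$.
   Context: A tree-controlled grammar is a quintuple $G=(N,T,P,S,R)$ where $(N,T,P,S)$ is a context-free grammar (non-terminals $N$, terminals $T$, axiom $S$) whose rules are all non-erasing, except that the rule $S\to\lambda$ is allowed if $S$ does not occur on the right-hand side of any rule, and $R\subseteq (N\cup T)^*$ is a regular language (the control language). For a derivation tree $t$ of height $h$ and $0\le j\le h$, the word of level $j$ is the word formed by reading all nodes of depth $j$ from left to right. $L(G)$ consists of all $z\in T^*$ having a derivation tree $t$ whose leaves read from left to right give $z$ and such that the words of all levels of $t$, except the last level, belong to $R$. For a family $\mathcal F$ of regular languages, $\mathcal{TC}(\mathcal F)$ is the family of languages $L(G)$ of tree-controlled grammars $G=(N,T,P,S,R)$ with $R\in\mathcal F$. $\mathrm{CS}$ denotes the family of context-sensitive languages. Strictly locally testable languages: let $V$ be an alphabet and $k\ge1$. For $B,I,E\subseteq V^k$ and $F\subseteq V^{\le k-1}$ (words of length at most $k-1$), $\mathrm{slt}(B,I,E,F)$ denotes the language over $V$ consisting of all words in $F$ together with all words $a_1a_2\cdots a_n$ ($a_i\in V$, $n\ge k$) such that $a_1\cdots a_k\in B$, $a_{j+1}\cdots a_{j+k}\in I$ for every $j$ with $1\le j\le n-k-1$, and $a_{n-k+1}\cdots a_n\in E$. A language is strictly locally $k$-testable if it equals $\mathrm{slt}(B,I,E,F)$ for some such $V,B,I,E,F$;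 $\mathrm{SLT}_k$ is the family of these languages and $\mathrm{SLT}=\bigcup_{k\ge1}\mathrm{SLT}_k$. *)

(* Defs.v *)
From mathcomp Require Import all_boot.
From Stdlib Require Import Relations.

Set Implicit Arguments.
Unset Strict Implicit.
Unset Printing Implicit Defensive.

Definition lang (T : Type) := seq T -> Prop.

Definition lang_family := forall V : finType, lang V -> Prop.

Section SLT.
Variable V : finType.

Definition slt (k : nat) (B I E F : seq V -> Prop) (w : seq V) : Prop :=
  F w \/
  [/\ k <= size w,
      B (take k w),
      (forall j, 1 <= j -> j <= size w - k - 1 -> I (take k (drop j w)))
    & E (drop (size w - k) w)].

Definition SLT_k (k : nat) (R : lang V) : Prop :=
  1 <= k /\
  exists (B I E F : seq V -> Prop),
    [/\ (forall x, B x -> size x = k),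
        (forall x, I x -> size x = k),
        (forall x, E x -> size x = k),
        (forall x, F x -> size x <= k - 1)
      & forall w, R w <-> slt k B I E F w].

Definition SLT (R : lang V) : Prop := exists k, SLT_k k R.
End SLT.

Definition SLTk_family (k : nat) : lang_family := fun V R => SLT_k k R.
Definition SLT_family : lang_family := fun V R => SLT R.

(** * Derivation trees of context-free grammars
    Symbols are [N + T] (nonterminals [inl], terminals [inr]).
    A leaf labelled lambda (from the rule S -> lambda) is [DEps]. *)
Inductive dtree (N T : Type) : Type :=
  | DLeaf of T
  | DEps
  | DNode of N & seq (dtree N T).
Arguments DEps {N T}.

Section Trees.
Variables (N T : finType).
Notation sym := (N + T)%type.

Fixpoint level (j : nat) (t : dtree N T) {struct t} : seq sym :=
  match t with
  | DLeaf a => if j is 0 then [:: inr a] else [::]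
  | DEps => [::]
  | DNode A ch =>
      match j with
      | 0 => [:: inl A]
      | j'.+1 => flatten (map (level j') ch)
      end
  end.

Fixpoint height (t : dtree N T) : nat :=
  match t with
  | DLeaf _ => 0
  | DEps => 0
  | DNode _ ch => (foldr maxn 0 (map height ch)).+1
  end.

Fixpoint yield (t : dtree N T) : seq T :=
  match t with
  | DLeaf a => [:: a]
  | DEps => [::]
  | DNode _ ch => flatten (map yield ch)
  end.

Definition is_eps (t : dtree N T) : bool := if t is DEps then true else false.

Definition dlabel (t : dtree N T) : option sym :=
  match t with
  | DLeaf a => Some (inr a)
  | DEps => None
  | DNode A _ => Some (inl A)
  end.

Fixpoint valid (P : seq (N * seq sym)) (t : dtree N T) : Prop :=
  match t with
  | DLeaf _ => True
  | DEps => True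
  | DNode A ch =>
      ((ch = [:: DEps] /\ (A, [::]) \in P) \/
       (all (fun c => ~~ is_eps c) ch /\
        (A, pmap dlabel ch) \in P)) /\
      (fix all_valid (l : seq (dtree N T)) : Prop :=
         match l with
         | [::] => True
         | c :: l' => valid P c /\ all_valid l'
         end) ch
  end.
End Trees.

Definition cf_wf (N T : finType) (P : seq (N * seq (N + T))) (S : N) : Prop :=
  forall A w, (A, w) \in P -> w = [::] ->
    A = S /\ forall B w', (B, w') \in P -> inl S \notin w'.

Definition tc_lang (N T : finType) (P : seq (N * seq (N + T))) (S : N)
    (R : lang (N + T)) : lang T :=
  fun z => exists ch : seq (dtree N T),
    let t := DNode S ch in
    [/\ valid P t, yield t = z &
        forall j, j < height t -> R (level j t)].

Definition TC (F : lang_family) : lang_family :=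
  fun T L => exists (N : finType) (P : seq (N * seq (N + T))) (S : N)
                    (R : lang (N + T)),
    [/\ cf_wf P S, F _ R & forall z, L z <-> tc_lang P S R z].

Section CS.
Variables (N T : finType).
Notation sym := (N + T)%type.

Definition cs_rules_ok (P : seq (seq sym * seq sym)) (S : N) : Prop :=
  forall l r, (l, r) \in P ->
    (exists u v w (A : N), [/\ l = u ++ inl A :: v, r = u ++ w ++ v & w != [::]])
    \/ (l = [:: inl S] /\ r = [::] /\
        forall l' r', (l', r') \in P -> inl S \notin r').

Definition cs_step (P : seq (seq sym * seq sym)) (x y : seq sym) : Prop :=
  exists x1 x2 l r, [/\ (l, r) \in P, x = x1 ++ l ++ x2 & y = x1 ++ r ++ x2].

Definition cs_lang (P : seq (seq sym * seq sym)) (S : N) : lang T :=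
  fun z => clos_refl_trans _ (cs_step P) [:: inl S] (map inr z).
End CS.

Definition CS : lang_family :=
  fun T L => exists (N : finType) (P : seq (seq (N + T) * seq (N + T))) (S : N),
    cs_rules_ok P S /\ forall z, L z <-> cs_lang P S z.

Arguments TC F V L : clear implicits.
Arguments CS V L : clear implicits.
Arguments SLTk_family k V R : clear implicits.
Arguments SLT_family V R : clear implicits.

(* Main.v *)
(** From tree-controlled to context-sensitive: a strictly locally testable language is accepted by a DFA,
    so a derivation tree can be produced level by level by a length-nondecreasing process whose cells carry
    the sentential form.  In each phase a forward sweep rewrites the cells from left to right while passing
    the DFA state to the right neighbour, and a backward sweep makes all cells ready for the next phase.
    Each rule rewrites one cell in the context of one neighbour.  Terminals generated at earlier levels
    stay in the word but are invisible to the DFA.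

    From context-sensitive to tree-controlled: an application of [uAv -> uwv] is announced by replacing the
    symbols of an occurrence of [uAv] by marks naming the rule and the position in its left-hand side;
    whether all marks form complete left-hand sides depends only on adjacent pairs and on the two ends of
    the level.  On the next level each mark is rewritten by its own contribution to [uwv]. *)

Require Import Defs.
From mathcomp Require Import all_boot zify.
From mathcomp Require Import boolp.
From Stdlib Require Import Relations.

Set Implicit Arguments.
Unset Strict Implicit.
Unset Printing Implicit Defensive.

Arguments clos_refl_trans {A}.
Arguments clos_refl_trans_1n {A}.

(** * Finite lists of bounded words *)

Lemma exists_filter (X : eqType) (U : seq X) (p : X -> Prop) :
  exists s : seq X, forall x, x \in s <-> x \in U /\ p x.
Proof.
exists [seq x <- U | `[< p x >]] => x; rewrite mem_filter.
by split=> [/andP[/asboolP ? ?]|[? ?]] //; apply/andP; split=> //; apply/asboolP.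
Qed.

Lemma exists_words (V : finType) m :
  exists s : seq (seq V), forall w, w \in s <-> size w <= m.
Proof.
exists [seq bseqval w | w : {bseq m of V} <- enum {: {bseq m of V}}] => w; split.
  by case/mapP=> b _ ->; exact: size_bseq.
by move=> h; apply/mapP; exists (Bseq h); rewrite ?mem_enum.
Qed.

Lemma rhs_bound (X : eqType) (V : eqType) (s : seq (X * seq V)) :
  exists m, forall A w, (A, w) \in s -> size w <= m.
Proof.
elim: s => [|[A0 w0] s [m IH]]; first by exists 0.
exists (size w0 + m) => A w; rewrite inE => /orP[/eqP[_ ->]|/IH h].
  exact: leq_addr.
exact: leq_trans h (leq_addl _ _).
Qed.

Lemma cat_map_inv (A B : Type) (f : A -> B) s u v :
  map f s = u ++ v -> exists s1 s2, [/\ s = s1 ++ s2, map f s1 = u & map f s2 = v].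
Proof.
move=> h; exists (take (size u) s), (drop (size u) s).
by rewrite cat_take_drop map_take map_drop h take_size_cat ?drop_size_cat.
Qed.

(** * Level-by-level runs *)

Section DtreeInd.
Variables (N T : Type) (K : dtree N T -> Prop).
Hypothesis Kleaf : forall a, K (DLeaf N a).
Hypothesis Keps : K DEps.
Hypothesis Knode : forall A ch, (forall i, i < size ch -> K (nth DEps ch i)) -> K (DNode A ch).

(** The generated induction principle of [dtree] gives no hypothesis on the trees inside the list of
    children; the inner fixpoint provides one for each index. *)
Fixpoint dtree_nested_ind t : K t :=
  match t with
  | DLeaf a => Kleaf a
  | DEps => Keps
  | DNode A ch => Knode A (
      (fix all_nested l : forall i, i < size l -> K (nth DEps l i) :=
         match l return forall i, i < size l -> K (nth DEps l i) with
         | [::] => fun i h => match notF h with end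
         | c :: l' => fun i => match i return i < size (c :: l') -> K (nth DEps (c :: l') i) with
                              | 0 => fun _ => dtree_nested_ind c
                              | i'.+1 => fun h => all_nested l' i' h
                              end
         end) ch)
  end.
End DtreeInd.

Section Runs.
Variables (N T : finType) (P : seq (N * seq (N + T))).
Notation sym := (N + T)%type.
(* A sentential form during a run: [inl X] lies on the current level, [inr a] is a leaf of an earlier level. *)
Notation item := (sym + T)%type.

Definition active (x : seq item) : seq sym :=
  pmap (fun i => if i is inl X then Some X else None) x.

(** Only non-erasing rules are applied in a run; the erasing rule is treated at the root, in
    [tc_lang_run]. *)
Definition expand (i : item) (w : seq item) : Prop :=
  match i with
  | inl (inl A) => exists v, [/\ (A, v) \in P, v != [::] & w = map inl v]
  | inl (inr a) => w = [:: inr a]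
  | inr a => w = [:: inr a]
  end.

Fixpoint expands (x y : seq item) : Prop :=
  if x is i :: x' then exists w y', [/\ expand i w, expands x' y' & y = w ++ y']
  else y = [::].

Definition terminal_of (i : item) : option T :=
  match i with
  | inl (inl _) => None
  | inl (inr a) => Some a
  | inr a => Some a
  end.

(** Control is tested on the form that is left, never on the one that is reached, so the last level
    of a run stays unchecked. *)
Definition level_step (R : lang sym) (x y : seq item) : Prop :=
  R (active x) /\ expands x y.

Definition run_lang (R : lang sym) (S : N) : lang T := fun z =>
  exists2 y, clos_refl_trans (level_step R) [:: inl (inl S)] y
    & map terminal_of y = map Some z.

Lemma active_cat x y : active (x ++ y) = active x ++ active y.
Proof. exact: pmap_cat. Qed.

Lemma expand_nonnil i w : expand i w -> w != [::].
Proof. by case: i => [[A [v [_ h ->]]|a ->]|a ->] //; case: v h. Qed.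

Lemma expands_cat x1 x2 y1 y2 :
  expands x1 y1 -> expands x2 y2 -> expands (x1 ++ x2) (y1 ++ y2).
Proof.
elim: x1 y1 => [|i x1 IH] y1 /= => [-> //|[w [y' [hw /IH h ->]]] /h h2].
by exists w, (y' ++ y2); rewrite catA.
Qed.

Lemma expands_cat_inv x1 x2 y : expands (x1 ++ x2) y ->
  exists y1 y2, [/\ y = y1 ++ y2, expands x1 y1 & expands x2 y2].
Proof.
elim: x1 y => [|i x1 IH] y /=; first by exists [::], y.
move=> [w [y' [hw /IH [y1 [y2 [-> h1 h2]]] ->]]].
by exists (w ++ y1), y2; split; rewrite ?catA //; exists w, y1.
Qed.

Lemma expands1 i w : expand i w -> expands [:: i] w.
Proof. by exists w, [::]; rewrite cats0. Qed.

Lemma expands_nil x : expands x [::] -> x = [::].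
Proof.
case: x => [//|i x] [w [y' [/expand_nonnil hw _ /eqP]]].
by rewrite eq_sym; case: w hw.
Qed.

(** Strict validity: no empty-word leaf and no node without children, hence only non-erasing
    rules. *)
Fixpoint svalid (t : dtree N T) : bool :=
  match t with
  | DLeaf _ => true
  | DEps => false
  | DNode A ch => [&& ~~ nilp ch, (A, pmap (@dlabel N T) ch) \in P & all svalid ch]
  end.

Lemma svalid_label t : svalid t -> exists X, dlabel t = Some X.
Proof. by case: t => [a|//|A ch] _; eexists. Qed.

Lemma svalid_labels ch : all svalid ch ->
  map (@dlabel N T) ch = map Some (pmap (@dlabel N T) ch).
Proof.
elim: ch => [//|t ch IH] /= /andP[/svalid_label[X ->] /IH ->] //.
Qed.

Lemma mem_labels ch i X : i < size ch -> dlabel (nth DEps ch i) = Some X ->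
  X \in pmap (@dlabel N T) ch.
Proof.
elim: ch i => [//|c ch IH] [_ /= -> /=|i hi /IH h]; first by rewrite inE eqxx.
by rewrite /=; case: (dlabel c) => [Y|]; rewrite /= ?inE h ?orbT.
Qed.

Lemma svalid_valid t : svalid t -> valid P t.
Proof.
elim/dtree_nested_ind: t => // A ch IH /= /and3P[_ hP hch]; split.
  right; split=> //; apply: sub_all hch; by case.
elim: ch hch IH {hP} => [//|c ch IHch] /= /andP[hc hch] IH; split.
  exact: (IH 0).
by apply: IHch => // i hi; apply: (IH i.+1).
Qed.

Lemma valid_children A ch : valid P (DNode A ch) ->
  forall i, i < size ch -> valid P (nth DEps ch i).
Proof.
move=> [_]; elim: ch => [//|c ch IH] [hc hch] [//|i] /= hi.
exact: IH.
Qed.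

(** * Confining the erasing rule to the root *)

Section Valid.
Variable S : N.
Hypothesis wfP : cf_wf P S.

Lemma valid_svalid_node A ch : valid P (DNode A ch) -> all (fun c => ~~ is_eps c) ch ->
  (A, pmap (@dlabel N T) ch) \in P -> ~~ nilp ch ->
  (forall i, i < size ch -> valid P (nth DEps ch i) -> ~~ is_eps (nth DEps ch i) ->
     ((S, [::]) \in P -> dlabel (nth DEps ch i) <> Some (inl S)) -> svalid (nth DEps ch i)) ->
  svalid (DNode A ch).
Proof.
move=> hv hne hP hnil IH /=; apply/and3P; split=> //.
apply/(all_nthP DEps) => i hi; apply: IH => //; first exact: valid_children hv i hi.
  by move/(all_nthP DEps): hne; apply.
move=> hS hl; have [_ /(_ _ _ hP) /negP] := wfP hS erefl; apply.
exact: mem_labels hi hl.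
Qed.

(** By well-formedness an erasing node is labelled [S], and [S] then labels no child of any node;
    the last hypothesis passes this exclusion down the tree. *)
Lemma valid_svalid t : valid P t -> ~~ is_eps t ->
  ((S, [::]) \in P -> dlabel t <> Some (inl S)) -> svalid t.
Proof.
elim/dtree_nested_ind: t => // A ch IH hv _ hA.
have hAP : (A, [::]) \notin P.
  by apply/negP => h; have [e _] := wfP h erefl; apply: hA; rewrite -e.
case: (hv) => [[[_ /idP]|[hne hP] _]]; first by rewrite (negPf hAP).
apply: valid_svalid_node => //.
by apply/negP; case: {IH hv hA hne} ch hP => // hP; rewrite hP in hAP.
Qed.

Lemma valid_svalid_root ch : valid P (DNode S ch) ->
  [/\ yield (DNode S ch) = [::], height (DNode S ch) > 0 & (S, [::]) \in P] \/
  svalid (DNode S ch).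
Proof.
(* An erasing root has either the single child [DEps] or no child at all; both trees have height one
   and empty yield. *)
move=> hv; case: (hv) => [[[-> hP]|[hne hP] _]]; first by left.
case: (boolP (nilp ch)) => hnil.
  by left; case: {hne hv} ch hnil hP.
by right; apply: valid_svalid_node => // i _ hvi hi; exact: valid_svalid.
Qed.

End Valid.

(** * From derivation trees to runs *)

Fixpoint frontier (j : nat) (t : dtree N T) {struct t} : seq item :=
  match t with
  | DLeaf a => if j is 0 then [:: inl (inr a)] else [:: inr a]
  | DEps => [::]
  | DNode A ch => if j is j'.+1 then flatten (map (frontier j') ch) else [:: inl (inl A)]
  end.

Lemma active_frontier j t : active (frontier j t) = level j t.
Proof.
elim/dtree_nested_ind: t j => [a|//|A ch IH] [|j] //=.
elim: ch IH => [//|c ch IHch] IH /=.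
rewrite active_cat (IH 0) // IHch // => i hi; exact: (IH i.+1).
Qed.

Lemma frontier0 ch : all svalid ch ->
  flatten (map (frontier 0) ch) = map inl (pmap (@dlabel N T) ch).
Proof. by elim: ch => [//|[a|//|A c] ch IH] /= => [|/andP[_]] /IH ->. Qed.

Lemma frontier_expands t j : svalid t -> expands (frontier j t) (frontier j.+1 t).
Proof.
elim/dtree_nested_ind: t j => [a|//|A ch IH] j.
  by case: j => [|j] _; exact: expands1.
move=> /and3P[hnil hP hch]; case: j => [|j].
  apply: expands1; rewrite [frontier 1 _]/= frontier0 //.
  exists (pmap (@dlabel N T) ch); split=> //.
  move: (congr1 size (svalid_labels hch)); rewrite !size_map.
  by case: ch hnil {IH hP hch} => // c ch _; case: (pmap _ _).
rewrite /=; elim: ch hch IH {hP hnil} => [//|c ch IHch] /andP[hc hch] IH.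
rewrite !map_cons; apply: expands_cat; first exact: (IH 0).
by apply: IHch => // i hi k; exact: (IH i.+1).
Qed.

Lemma frontier_height t j : svalid t -> height t <= j ->
  map terminal_of (frontier j t) = map Some (yield t).
Proof.
elim/dtree_nested_ind: t j => [a|//|A ch IH] j; first by case: j.
move=> /and3P[_ _ hch]; case: j => [//|j] /=; rewrite ltnS.
elim: ch hch IH => [//|c ch IHch] /andP[hc hch] IH /=.
rewrite geq_max => /andP[hj hjs].
rewrite !map_cat (IH 0) // IHch // => i hi k; exact: (IH i.+1).
Qed.

Lemma tree_run R S ch : svalid (DNode S ch) ->
  (forall j, j < height (DNode S ch) -> R (level j (DNode S ch))) ->
  run_lang R S (yield (DNode S ch)).
Proof.
set t := DNode S ch => ht hR.
exists (frontier (height t) t); last exact: frontier_height.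
have: height t <= height t by [].
elim: {1 3}(height t) => [|n IH] hn; first exact: rt_refl.
apply: rt_trans (IH (ltnW hn)) _; apply: rt_step; split.
  by rewrite active_frontier; exact: hR.
exact: frontier_expands.
Qed.

(** * From runs to derivation trees *)

Notation ftree := (T + dtree N T)%type.

(** [inl a] stands for a leaf of an earlier level: it counts for the yield but for no level
    below. *)
Definition flabel (u : ftree) : option item :=
  match u with inl a => Some (inr a) | inr t => omap inl (dlabel t) end.
Definition fvalid (u : ftree) : bool := if u is inr t then svalid t else true.
Definition fyield (u : ftree) : seq T :=
  match u with inl a => [:: a] | inr t => yield t end.
Definition flevel j (u : ftree) : seq sym := if u is inr t then level j t else [::].
Definition fheight (u : ftree) : nat := if u is inr t then height t else 0.

Lemma flevel0 us x : map flabel us = map Some x -> flatten (map (flevel 0) us) = active x.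
Proof.
elim: us x => [|u us IH] [|i x] //= [hu /IH ->].
by case: u hu => [a [<-]|[a [<-]|//|A ch [<-]]].
Qed.

Lemma terminal_forest y z : map terminal_of y = map Some z ->
  exists us, [/\ map flabel us = map Some y, all fvalid us, flatten (map fyield us) = z
              & all (fun u => fheight u <= 0) us].
Proof.
elim: y z => [|i y IH] [|a z] //=; first by exists [::].
move=> [hi /IH [us [h1 h2 h3 h4]]].
case: i hi => [[//|_ [->]]|_ [->]].
  by exists (inr (DLeaf _ a) :: us); rewrite /= h1 h2 h3 h4.
by exists (inl a :: us); rewrite /= h1 h2 h3 h4.
Qed.

Lemma inl_forest v us : map flabel us = map (fun X => Some (inl X)) v ->
  all fvalid us -> exists2 ch, us = map inr ch & pmap (@dlabel N T) ch = v.
Proof.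
elim: v us => [|X v IH] [|u us] //=; first by exists [::].
move=> [hu /IH h] /andP[hv /h [ch -> hch]].
case: u hu hv => [//|t] /= ht hv; exists (t :: ch) => //=.
by case: (dlabel t) ht => //= Y [->]; rewrite /= hch.
Qed.

Lemma expand_forest n i w us : expand i w -> map flabel us = map Some w ->
  all fvalid us -> all (fun u => fheight u <= n) us ->
  exists u, [/\ flabel u = Some i, fvalid u, fyield u = flatten (map fyield us),
    fheight u <= n.+1 & forall j, flevel j.+1 u = flatten (map (flevel j) us)].
Proof.
case: i => [[A|a]|a].
- move=> [v [hP hv ->]]; rewrite -map_comp => hus hval hh.
  have [ch e1 e2] := inl_forest hus hval; subst us v; exists (inr (DNode A ch)); split=> //=.
  + apply/and3P; split=> //; last by rewrite all_map in hval.
    by case: ch hv {hP hus hval hh}.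
  + by rewrite -map_comp.
  + rewrite ltnS; rewrite all_map in hh; elim: ch hh {hP hv hus hval} => //= c ch IH /andP[h /IH].
    by rewrite geq_max h.
  + by move=> j; rewrite -map_comp.
- move=> ->; case: us => [//|u [|//]] /= [hu] _ _.
  exists (inr (DLeaf _ a)); case: u hu => [b [->]|[b //|//|//]]; split=> //.
- move=> ->; case: us => [//|u [|//]] /= [hu] _ _.
  by exists (inl a); case: u hu => [b [->]|[b //|//|//]]; split.
Qed.

Lemma expands_forest n x y us : expands x y -> map flabel us = map Some y ->
  all fvalid us -> all (fun u => fheight u <= n) us ->
  exists us', [/\ map flabel us' = map Some x, all fvalid us',
    flatten (map fyield us') = flatten (map fyield us),
    all (fun u => fheight u <= n.+1) us'
    & forall j, flatten (map (flevel j.+1) us') = flatten (map (flevel j) us)].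
Proof.
elim: x y us => [|i x IH] y us /=.
  by move=> ->; case: us => // _ _ _; exists [::]; split.
move=> [w [y' [hi hx ->]]]; rewrite map_cat => /cat_map_inv [u1 [u2 [-> h1 h2]]].
rewrite !all_cat => /andP[v1 v2] /andP[l1 l2].
have [u [a1 a2 a3 a4 a5]] := expand_forest hi h1 v1 l1.
have [us' [b1 b2 b3 b4 b5]] := IH _ _ hx h2 v2 l2.
exists (u :: us') => /=; rewrite a1 a2 a3 a4 b1 b2 b3 b4 !map_cat !flatten_cat; split=> //.
by move=> j; rewrite a5 b5 !map_cat flatten_cat.
Qed.

(** Read from its end, a run builds a forest upwards: the last form gives trees of height 0, and
    each step puts one more level on top. The number [n] counts the steps and bounds the heights. *)
Lemma run_forest R x y z : clos_refl_trans_1n (level_step R) x y ->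
  map terminal_of y = map Some z ->
  exists n us, [/\ map flabel us = map Some x, all fvalid us, flatten (map fyield us) = z,
    all (fun u => fheight u <= n) us
    & forall j, j < n -> R (flatten (map (flevel j) us))].
Proof.
elim=> {x y} [y /terminal_forest [us [? ? ? ?]]|x x1 y [hR hx] _ IH /IH [n [us [h1 h2 h3 h4 h5]]]].
  by exists 0, us.
have [us' [b1 b2 b3 b4 b5]] := expands_forest hx h1 h2 h4.
exists n.+1, us'; split=> //; first by rewrite b3.
case=> [_|j hj]; first by rewrite (flevel0 b1).
by rewrite b5; exact: h5.
Qed.

Lemma run_tree R S z : run_lang R S z -> tc_lang P S R z.
Proof.
case=> y hrun hy.
have [n [us [h1 h2 h3 h4 h5]]] := run_forest (clos_rt_rt1n _ _ _ _ hrun) hy.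
case: us h1 h2 h3 h4 h5 => [//|u [|//]] /= [].
case: u => [//|[//|//|B ch]] [->].
rewrite cats0 !andbT => h2 h3 h4 h5.
exists ch; split=> //; first exact: svalid_valid.
move=> j hj; have /= := h5 j (leq_trans hj h4).
by rewrite cats0.
Qed.

(** The tree of the erasing rule has height one, so its only controlled level is the word [S]; every
    other tree is strict and corresponds to a run. *)
Lemma tc_lang_run R S z : cf_wf P S ->
  tc_lang P S R z <->
  [/\ z = [::], (S, [::]) \in P & R [:: inl S]] \/ run_lang R S z.
Proof.
move=> wfP; split.
  case=> ch [hv <- hR]; case: (valid_svalid_root wfP hv) => [[h1 h2 h3]|h].
    by left; split=> //; exact: (hR 0 h2).
  by right; exact: tree_run.
case=> [[-> hP hR]|]; last exact: run_tree.
exists [:: DEps]; split=> //; first by split=> //; left.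
by case.
Qed.

End Runs.

(** * Strictly locally testable languages are regular *)

Definition dfa_recognizable (V : finType) (R : lang V) : Prop :=
  exists (Q : finType) (q0 : Q) (d : Q -> V -> Q) (F : Q -> Prop),
    forall w, R w <-> F (foldl d q0 w).

Section SltDfa.
Variables (V : finType) (k : nat) (I : seq V -> Prop).

Definition suffix (w : seq V) := drop (size w - k) w.

Lemma prefix_size (w : seq V) : size (take k w) <= k.
Proof. by rewrite size_take_min geq_minl. Qed.

Lemma suffix_size w : size (suffix w) <= k.
Proof. rewrite size_drop; lia. Qed.

(* Prefix and suffix of length at most [k], whether all inner windows lie in [I], whether the length exceeds [k]. *)
Definition slt_state : finType := ({bseq k of V} * {bseq k of V} * bool * bool)%type.

Definition slt_next (q : slt_state) (a : V) : slt_state :=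
  let: (p, s, ok, long) := q in
  (Bseq (prefix_size (rcons p a)), Bseq (suffix_size (rcons s a)),
   ok && (long ==> `[< I s >]), size p == k).

Definition inner_windows (w : seq V) : Prop :=
  forall j, 1 <= j -> j <= size w - k - 1 -> I (take k (drop j w)).

Definition slt_summary (w : seq V) : slt_state :=
  (Bseq (prefix_size w), Bseq (suffix_size w), `[< inner_windows w >], k < size w).

Hypothesis k_gt0 : 0 < k.

(** Appending a letter to [w] makes the last [k] letters of [w] an inner window, unless they are
    also its first window; no other inner window is new. *)
Lemma inner_windows_rcons w a :
  inner_windows (rcons w a) <-> inner_windows w /\ (k < size w -> I (suffix w)).
Proof.
have old j : j + k <= size w -> take k (drop j (rcons w a)) = take k (drop j w).
  move=> h; rewrite drop_rcons; last by lia.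
  by rewrite -cats1 takel_cat // size_drop; lia.
have last : k < size w -> take k (drop (size w - k) w) = suffix w.
  by move=> h; rewrite take_oversize // size_drop; lia.
rewrite /inner_windows size_rcons; split=> [h|[h hk] j h1 h2].
  split=> [j h1 h2|h1]; first by rewrite -old; [apply: h|]; lia.
  by rewrite -last // -old; [apply: h|]; lia.
rewrite old; last by lia.
case: (leqP j (size w - k - 1)) => hj; first exact: h.
have -> : j = size w - k by lia.
by rewrite last; [apply: hk|]; lia.
Qed.

Lemma slt_summary_rcons w a : slt_summary (rcons w a) = slt_next (slt_summary w) a.
Proof.
rewrite /slt_summary /slt_next; congr (_, _, _, _).
- apply: val_inj => /=; rewrite -!cats1 !take_cat size_take_min.
  rewrite (ltnNge k (minn _ _)) geq_minl /=.
  have [h1|] := boolP (k < size w).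
    by rewrite (minn_idPl (ltnW h1)) subnn take0 cats0.
  rewrite -leqNgt => h1; rewrite (minn_idPr h1).
  by rewrite [take k w]take_oversize.
- apply: val_inj => /=; rewrite /suffix !size_rcons size_drop.
  case: (leqP (size w) k) => h; first by rewrite (_ : size w - k = 0) ?drop0 ?subn0; last by lia.
  rewrite !drop_rcons ?size_drop; try lia.
  rewrite drop_drop; congr (rcons (drop _ _) _); lia.
- apply/idP/idP => [/asboolP /inner_windows_rcons[h1 h2]|/andP[/asboolP h1 /implyP h2]].
    by apply/andP; split; [apply/asboolP | apply/implyP => h; apply/asboolP; exact: h2].
  by apply/asboolP/inner_windows_rcons; split=> // h; apply/asboolP; exact: h2.
(* The extended word is longer than [k] exactly when the prefix stored for [w] already has length
   [k]. *)
- rewrite size_rcons /= size_take_min; apply/idP/eqP; lia.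
Qed.

Lemma slt_summary_foldl w : slt_summary w = foldl slt_next (slt_summary [::]) w.
Proof.
by elim/last_ind: w => [//|w a IH]; rewrite slt_summary_rcons foldl_rcons IH.
Qed.

End SltDfa.

(** The summary is updated letter by letter and decides membership: a stored prefix shorter than [k]
    is the whole word, and only such a word can lie in [F]. *)
Lemma SLT_k_dfa (V : finType) k (R : lang V) : SLT_k k R -> dfa_recognizable R.
Proof.
move=> [k1 [B [I [E [F [hB hI hE hF hR]]]]]].
exists (slt_state V k), (slt_summary k I [::]), (@slt_next V k I),
  (fun q : slt_state V k => let: (p, s, ok, _) := q in
    F p \/ [/\ size p = k, B p, ok & E s]) => w.
rewrite -slt_summary_foldl // hR /slt /slt_summary /=; split.
  case=> [hw|[h1 h2 h3 h4]].
    by left; rewrite take_oversize //; have := hF _ hw; lia.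
  by right; split=> //; [rewrite size_takel | apply/asboolP].
case=> [h|[h1 h2 /asboolP h3 h4]].
  left; have := hF _ h; rewrite size_take_min => hk.
  by rewrite take_oversize in h; last by lia.
by right; split=> //; move: h1; rewrite size_take_min; lia.
Qed.

(** * Simulating level-by-level runs by a context-sensitive grammar *)

Lemma cat_cons_inv (A : Type) (s1 s2 u v : seq A) c :
  s1 ++ s2 = u ++ c :: v ->
  (exists2 v1, s1 = u ++ c :: v1 & v = v1 ++ s2) \/
  (exists2 u2, s2 = u2 ++ c :: v & u = s1 ++ u2).
Proof.
elim: s1 u => [|x s1 IH] u /= h; first by right; exists u.
case: u h => [|y u] /=; first by case=> <- <-; left; exists s1.
by case=> -> /IH [[v1 -> ->]|[u2 -> ->]]; [left; exists v1 | right; exists u2].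
Qed.

Lemma rcons_nonnil (A : eqType) (s : seq A) : s != [::] -> exists s' x, s = rcons s' x.
Proof. by case/lastP: s => // s x _; exists s, x. Qed.

(** * String rewriting *)

Section Rewriting.
Variables (A : Type) (rule : seq A -> seq A -> Prop).

Definition rewrites (x y : seq A) : Prop :=
  exists u v l r, [/\ rule l r, x = u ++ l ++ v & y = u ++ r ++ v].

Lemma rewrites_star_ctx u v x y : clos_refl_trans rewrites x y ->
  clos_refl_trans rewrites (u ++ x ++ v) (u ++ y ++ v).
Proof.
elim=> {x y} [x y [u' [v' [l [r [h -> ->]]]]]|x|x y z _ h1 _ h2].
- by apply: rt_step; exists (u ++ u'), (v' ++ v), l, r; rewrite !catA.
- exact: rt_refl.
- exact: rt_trans h1 h2.
Qed.

Lemma rewrites_star_catl u x y : clos_refl_trans rewrites x y ->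
  clos_refl_trans rewrites (u ++ x) (u ++ y).
Proof. by move/(rewrites_star_ctx u [::]); rewrite !cats0. Qed.

End Rewriting.

Lemma rewrites_star_map (A B : Type) (f : A -> B) (ruleA : seq A -> seq A -> Prop)
    (ruleB : seq B -> seq B -> Prop) x y :
  (forall l r, ruleA l r -> ruleB (map f l) (map f r)) ->
  clos_refl_trans (rewrites ruleA) x y ->
  clos_refl_trans (rewrites ruleB) (map f x) (map f y).
Proof.
move=> hf; elim=> {x y} [x y [u [v [l [r [h -> ->]]]]]|x|x y z _ h1 _ h2].
- by apply: rt_step; exists (map f u), (map f v), (map f l), (map f r); rewrite !map_cat; split; auto.
- exact: rt_refl.
- exact: rt_trans h1 h2.
Qed.

(** * Cells and the two sweeps *)

Section Sweeps.
Variables (N T : finType) (P : seq (N * seq (N + T))) (S : N).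
Variables (Q : finType) (q0 : Q) (d : Q -> N + T -> Q) (F : Q -> Prop).
Notation item := (N + T + T)%type.

(* [(i, b, s, lf, rf)]: [s = None] marks a cell that the forward sweep of phase [b] has not reached yet,
   [s = Some q] one it has rewritten, [q] being the state reached; [lf] and [rf] mark the two ends of the word. *)
Notation cell := (item * bool * option Q * bool * bool)%type.

Definition item_next (q : Q) (i : item) : Q := if i is inl X then d q X else q.

Lemma item_next_foldl q x : foldl item_next q x = foldl d q (active x).
Proof. by elim: x q => [//|[X|a] x IH] q /=; rewrite IH. Qed.

Fixpoint paint (lf rf b : bool) (s : option Q) (w : seq item) : seq cell :=
  if w is i :: w' then (i, b, s, lf, rf && nilp w') :: paint false rf b s w' else [::].

Lemma paint_cat lf rf b s w1 w2 : paint lf rf b s (w1 ++ w2) =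
  paint lf (rf && nilp w2) b s w1 ++ paint (lf && nilp w1) rf b s w2.
Proof.
elim: w1 lf => [|i w1 IH] lf /=; first by rewrite andbT.
rewrite IH andbF /= -andbA; congr ((_, _) :: _); congr (_ && _).
by rewrite /nilp size_cat addn_eq0 andbC.
Qed.

Lemma paint_split lf rf b s w u c v : paint lf rf b s w = u ++ c :: v ->
  exists w1 i w2, [/\ w = w1 ++ i :: w2, u = paint lf false b s w1,
    c = (i, b, s, lf && nilp w1, rf && nilp w2) & v = paint false rf b s w2].
Proof.
elim: u w lf => [|x u IH] [|i w] lf //= [].
  by move=> <- <-; exists [::], i, w; rewrite andbT.
move=> <- /IH [w1 [j [w2 [-> -> -> ->]]]]; exists (i :: w1), j, w2.
by rewrite /= !andbF; split=> //; rewrite /nilp size_cat addnS andbF.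
Qed.

Lemma paint_rcons lf rf b s w : w != [::] ->
  exists u i lf', paint lf rf b s w = rcons u (i, b, s, lf', rf).
Proof.
move=> /rcons_nonnil [w' [i ->]]; exists (paint lf false b s w'), i, (lf && nilp w').
by rewrite -cats1 paint_cat /= andbF andbT cats1.
Qed.

Lemma paint_nil lf rf b s w : paint lf rf b s w = [::] -> w = [::].
Proof. by case: w. Qed.

(** [Forward_next] needs equal phase bits in its two cells and [Backward_prev] opposite ones, so the
    bit tells the sweeps apart. The end marks say where a sweep starts, and [F] is tested when the
    last cell is rewritten. *)
Inductive cell_rule : seq cell -> seq cell -> Prop :=
| Forward_first i b (rf : bool) w : expand P i w -> (rf -> F (item_next q0 i)) ->
    cell_rule [:: (i, b, None, true, rf)] (paint true rf b (Some (item_next q0 i)) w)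
| Forward_next i0 q lf0 i b (rf : bool) w : expand P i w -> (rf -> F (item_next q i)) ->
    cell_rule [:: (i0, b, Some q, lf0, false); (i, b, None, false, rf)]
              ((i0, b, Some q, lf0, false) :: paint false rf b (Some (item_next q i)) w)
| Backward_last i b q lf :
    cell_rule [:: (i, b, Some q, lf, true)] [:: (i, ~~ b, None, lf, true)]
| Backward_prev i b q lf i1 rf1 :
    cell_rule [:: (i, b, Some q, lf, false); (i1, ~~ b, None, false, rf1)]
              [:: (i, ~~ b, None, lf, false); (i1, ~~ b, None, false, rf1)].

Notation cell_star := (clos_refl_trans (rewrites cell_rule)).

(** The states left in the swept part differ from cell to cell; replacing them all by [q0] lets that
    part be described by a single [paint]. *)
Definition forget (c : cell) : cell :=
  let: (i, b, s, lf, rf) := c in (i, b, omap (fun _ => q0) s, lf, rf).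

Lemma forget_paint lf rf b q w :
  map forget (paint lf rf b (Some q) w) = paint lf rf b (Some q0) w.
Proof. by elim: w lf => [//|i w IH] lf /=; rewrite IH. Qed.

(** Induction on the unswept part [x]: [pre] is the swept part, and unless the sweep is just
    starting its last cell carries [q]. *)
Lemma forward_sweep x y pre lf q b : x != [::] -> expands P x y ->
  F (foldl item_next q x) ->
  (if lf then q = q0 else exists pre' i0 lf0, pre = rcons pre' (i0, b, Some q, lf0, false)) ->
  exists2 c, map forget c = paint lf true b (Some q0) y
    & cell_star (pre ++ paint lf true b None x) (pre ++ c).
Proof.
elim: x y pre lf q => [//|i x IH] y pre lf q _ [w [y' [hi hx ->]]] hF hl.
have hstep : nilp x -> F (item_next q i) by case: x hF {IH hx}.
have step : cell_star (pre ++ paint lf true b None (i :: x))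
   (pre ++ paint lf (nilp x) b (Some (item_next q i)) w ++ paint false true b None x).
  apply: rt_step; case: lf hl => [qq0|[pre' [i0 [lf0 ->]]]].
    subst q; exists pre, (paint false true b None x); do 2!eexists.
    split; first exact: (@Forward_first i b (nilp x) w).
      by [].
    by [].
  exists pre', (paint false true b None x); do 2!eexists; split.
  - exact: (@Forward_next i0 q lf0 i b (nilp x) w).
  - by rewrite /= cat_rcons.
  - by rewrite cat_rcons.
have hw := expand_nonnil hi.
have [x0|xn0] := eqVneq x [::].
  subst x; move: hx step => /= -> /=; rewrite !cats0 => step.
  by exists (paint lf true b (Some (item_next q i)) w) => //; exact: forget_paint.
have xnil : nilp x = false by case: (x) xn0.
have [u [j [lf' hu]]] := paint_rcons lf false b (Some (item_next q i)) hw.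
(* The last cell painted for [w] carries the new state, as the induction hypothesis asks of the
   extended prefix. *)
have [c hc1 hc2] := IH y' (pre ++ paint lf false b (Some (item_next q i)) w) false _ xn0 hx hF
  (ex_intro _ (pre ++ u) (ex_intro _ j (ex_intro _ lf'
    (etrans (congr1 (cat pre) hu) (esym (rcons_cat _ _ _)))))).
exists (paint lf false b (Some (item_next q i)) w ++ c).
  rewrite map_cat forget_paint hc1 paint_cat.
  have -> : nilp y' = false by case: (y') hx => // /expands_nil h; rewrite h in xn0.
  have -> : nilp w = false by case: (w) hw.
  by rewrite ?andbF.
by apply: rt_trans step _; rewrite xnil !catA.
Qed.

Lemma backward_sweep y c lf b : map forget c = paint lf true b (Some q0) y ->
  cell_star c (paint lf true (~~ b) None y).
Proof.
elim: y c lf => [|i y IH] [|c1 c] lf //=; first by move=> _; exact: rt_refl.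
case: c1 => [[[[i' b'] [q|]] lf'] rf'] //= [-> -> -> ->] /IH h.
(* The tail is made ready first, because the head cell needs a ready right neighbour unless it is
   the last cell. *)
apply: rt_trans (rewrites_star_catl [:: (i, b, Some q, lf, nilp y)] h) _.
apply: rt_step; case: y {IH h} => [|j y] /=.
  exists [::], [::]; do 2!eexists; split; first exact: (@Backward_last i b q lf).
    by [].
  by [].
exists [::], (paint false true (~~ b) None y);
  do 2!eexists; split; first exact: (@Backward_prev i b q lf j (nilp y)).
  by [].
by [].
Qed.

(** * Cell words and reachable forms *)

Definition dfa_lang : lang (N + T) := fun w => F (foldl d q0 w).
Notation reach := (clos_refl_trans (level_step P dfa_lang) [:: inl (inl S)]).

Lemma level_step_cells x y b : x != [::] -> level_step P dfa_lang x y ->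
  cell_star (paint true true b None x) (paint true true (~~ b) None y).
Proof.
move=> hx [hF hxy]; rewrite /dfa_lang -item_next_foldl in hF.
have [c h1 h2] := @forward_sweep x y [::] true q0 b hx hxy hF erefl.
exact: rt_trans h2 (backward_sweep h1).
Qed.

Lemma level_step_nonnil R x y : x != [::] -> level_step P R x y -> y != [::].
Proof. by move=> hx [_ hxy]; apply/eqP => y0; rewrite y0 in hxy; move: hx; rewrite (expands_nil hxy). Qed.

Lemma reach_cells y : reach y ->
  exists b, cell_star (paint true true false None [:: inl (inl S)]) (paint true true b None y).
Proof.
move=> h; suff [] : y != [::] /\ exists b,
  cell_star (paint true true false None [:: inl (inl S)]) (paint true true b None y) by [].
elim/clos_refl_trans_ind_left: h => [|x z _ [hx [b hb]] hxz].
  by split=> //; exists false; exact: rt_refl.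
split; first exact: level_step_nonnil hxz.
by exists (~~ b); exact: rt_trans hb (level_step_cells b hx hxz).
Qed.

(** All cell words that a derivation can meet. Going forward, [x1] has been expanded to [y1], held
    by [d1], and [x2] is untouched; going backward, [x1 ++ x2] is already the next form and [x2] is
    ready for its phase. Rules apply only at the border between the parts. *)
Inductive sweeping (c : seq cell) : Prop :=
| Sweeping_forward b x1 x2 y1 d1 q :
    reach (x1 ++ x2) -> expands P x1 y1 -> foldl item_next q0 x1 = q ->
    map forget d1 = paint true (nilp x2) b (Some q0) y1 ->
    (x1 != [::] -> exists u i lf rf, d1 = rcons u (i, b, Some q, lf, rf)) ->
    (nilp x2 -> F q) ->
    c = d1 ++ paint (nilp x1) true b None x2 -> sweeping c
| Sweeping_backward b x1 x2 d1 :
    reach (x1 ++ x2) -> x2 != [::] ->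
    map forget d1 = paint true false b (Some q0) x1 ->
    c = d1 ++ paint (nilp x1) true (~~ b) None x2 -> sweeping c.

Lemma forget_split (lf rf b : bool) y d1 u i b' (s : option Q) (lf' rf' : bool) v :
  map forget d1 = paint lf rf b (Some q0) y -> d1 = u ++ (i, b', s, lf', rf') :: v ->
  exists q w1 w2, [/\ b' = b, s = Some q & y = w1 ++ i :: w2] /\
    [/\ map forget u = paint lf false b (Some q0) w1, lf' = lf && nilp w1,
        rf' = rf && nilp w2 & map forget v = paint false rf b (Some q0) w2].
Proof.
move=> h e; move: h; rewrite e map_cat /= => /esym/paint_split [w1 [j [w2 [-> hu [<- -> hs -> ->] hv]]]].
by case: s hs {e} => // q _; exists q, w1, w2.
Qed.

(** A ready word is either a forward sweep not yet begun or a finished backward sweep; both start a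
    new phase here. *)
Lemma sweeping_forward_first b b' i rf w u v x : reach x ->
  paint true true b None x = u ++ (i, b', None, true, rf) :: v ->
  expand P i w -> (rf -> F (item_next q0 i)) ->
  sweeping (u ++ paint true rf b' (Some (item_next q0 i)) w ++ v).
Proof.
move=> hr /paint_split [w1 [j [w2 [ex -> [ei eb h erf] ->]]]] hi hF; subst j b' rf.
case: w1 h ex => // _ ex.
apply: (@Sweeping_forward _ b [:: i] w2 w (paint true (nilp w2) b (Some (item_next q0 i)) w)) => //.
- by rewrite -[_ ++ _]ex.
- exact: expands1.
- exact: forget_paint.
- move=> _; have [u' [k [lf' ->]]] := paint_rcons true (nilp w2) b (Some (item_next q0 i)) (expand_nonnil hi).
  by exists u', k, lf', (nilp w2).
Qed.

(** For each rule and each sweep the matched cells are located relative to the border. Cells with a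
    state lie before it, cells without one behind it; phase bits and end marks exclude a rule of the
    wrong sweep. *)
Lemma sweeping_step c c' : sweeping c -> rewrites cell_rule c c' -> sweeping c'.
Proof.
move=> hc [u [v [l [r [hlr ec ->]]]]]; rewrite {}ec in hc.
case: hlr hc => {l r}.
(* A cell without state that is marked as left end forces the part before the border to be empty. *)
- move=> i b' rf w hi hF; case=> [b x1 x2 y1 d1 q|b x1 x2 d1].
    move=> hr hx hq hd _ _ /esym e; case: (cat_cons_inv e) => [[v1 e' _]|[u2 e' eu]].
      by have [? [? [? [[]]]]] := forget_split hd e'.
    have [w1 [j [w2 [_ _ [_ _ /esym/andP[/nilP x10 _] _] _]]]] := paint_split e'.
    subst x1; move: hx hd => /= ->; case: d1 e {eu} => // e _.
    exact: sweeping_forward_first hr e hi hF.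
  move=> hr hx2 hd /esym e; case: (cat_cons_inv e) => [[v1 e' _]|[u2 e' eu]].
    by have [? [? [? [[]]]]] := forget_split hd e'.
  have [w1 [j [w2 [_ _ [_ _ /esym/andP[/nilP x10 _] _] _]]]] := paint_split e'.
  subst x1; move: hd; case: d1 e {eu} => // e _.
  exact: sweeping_forward_first hr e hi hF.
(* The pair straddles the border and its left cell carries the [q] of the invariant; the border
   moves one item to the right. *)
- move=> i0 q' lf0 i b' rf w hi hF; case=> [b x1 x2 y1 d1 q|b x1 x2 d1].
    move=> hr hx hq hd hlast _ /esym e; case: (cat_cons_inv e) => [[v1 e1 e2]|[u2 e' _]]; last first.
      by have [? [? [? [_ _ ? _]]]] := paint_split e'.
    have [? [? [? [[eb _ _] _]]]] := forget_split hd e1; subst b'.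
    case: v1 e1 e2 => [|c1 v1] e1 /=; last first.
      move=> [ec1 _]; subst c1; rewrite -cat_rcons in e1.
      by have [? [? [? [[]]]]] := forget_split hd e1.
    move=> /esym e2; rewrite -[_ :: v]cat0s in e2.
    have [w1 [j [w2 [ex2 /esym/paint_nil w10 [ej elf erf] ev]]]] := paint_split e2; subst w1 j v rf x2.
    have x1n : x1 != [::] by move: elf; rewrite andbT; case: (x1).
    have [u' [k [lf' [rf']]]] := hlast x1n.
    rewrite e1 cats1 => /rcons_inj [_ _ eq _ _]; subst q'.
    have y1n : nilp y1 = false.
      by case: (y1) hx => // /expands_nil h; rewrite h in x1n.
    rewrite /= in hr hd.
    apply: (@Sweeping_forward _ b (rcons x1 i) w2 (y1 ++ w)
      (d1 ++ paint false (nilp w2) b (Some (item_next q i)) w) (item_next q i)).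
    + by rewrite cat_rcons.
    + by rewrite -cats1; apply: expands_cat => //; exact: expands1.
    + by rewrite -cats1 foldl_cat hq.
    + rewrite map_cat hd forget_paint paint_cat y1n.
      have -> : nilp w = false by move/expand_nonnil: hi; case: (w).
      by rewrite andbF.
    + move=> _.
      have [u2 [k2 [lf2 ->]]] := paint_rcons false (nilp w2) b (Some (item_next q i)) (expand_nonnil hi).
      by exists (d1 ++ u2), k2, lf2, (nilp w2); rewrite rcons_cat.
    + exact: hF.
    + rewrite e1 -!catA /=; case: (x1) x1n => //.
  (* In a backward sweep the two cells at the border have opposite phase bits, against the rule. *)
  move=> hr hx2 hd /esym e; case: (cat_cons_inv e) => [[v1 e1 e2]|[u2 e' _]]; last first.
    by have [? [? [? [_ _ ? _]]]] := paint_split e'.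
  have [? [? [? [[eb _ _] _]]]] := forget_split hd e1; subst b'.
  case: v1 e1 e2 => [|c1 v1] e1 /=; last first.
    move=> [ec1 _]; subst c1; rewrite -cat_rcons in e1.
    by have [? [? [? [[]]]]] := forget_split hd e1.
  move=> /esym e2; rewrite -[_ :: v]cat0s in e2.
  have [w1 [j [w2 [_ _ [_ eb _ _] _]]]] := paint_split e2.
  by case: (b) eb.
(* A cell with a state at the right end means that the forward sweep is complete; acceptance by [F]
   makes the new form reachable. *)
- move=> i b' q' lf; case=> [b x1 x2 y1 d1 q|b x1 x2 d1].
    move=> hr hx hq hd hlast hF /esym e; case: (cat_cons_inv e) => [[v1 e1 e2]|[u2 e' _]]; last first.
      by have [? [? [? [_ _ ? _]]]] := paint_split e'.
    have [q1 [w1 [w2 [[eb _ ey] [hu elf /esym/andP[/nilP x20 /nilP w20] hv]]]]] := forget_split hd e1.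
    subst x2 w2 b' v lf y1; case: v1 hv e1 e => // _ e1 e; rewrite /= !cats0 in hr e *.
    apply: (@Sweeping_backward _ b w1 [:: i] u) => //.
    apply: rt_trans hr _; apply: rt_step; split=> //.
    by rewrite /dfa_lang -item_next_foldl hq; exact: hF.
  move=> hr hx2 hd /esym e; case: (cat_cons_inv e) => [[v1 e1 e2]|[u2 e' _]]; last first.
    by have [? [? [? [_ _ ? _]]]] := paint_split e'.
  by have [q1 [w1 [w2 [_ []]]]] := forget_split hd e1.
(* In a forward sweep the cells at the border have equal bits, against the rule; in a backward sweep
   the border moves one item to the left. *)
- move=> i b' q' lf i1 rf1; case=> [b x1 x2 y1 d1 q|b x1 x2 d1].
    move=> hr hx hq hd hlast hF /esym e; case: (cat_cons_inv e) => [[v1 e1 e2]|[u2 e' _]]; last first.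
      by have [? [? [? [_ _ ? _]]]] := paint_split e'.
    have [? [? [? [[eb _ _] _]]]] := forget_split hd e1; subst b'.
    case: v1 e1 e2 => [|c1 v1] e1 /=; last first.
      move=> [ec1 _]; subst c1; rewrite -cat_rcons in e1.
      by have [? [? [? [[]]]]] := forget_split hd e1.
    move=> /esym e2; rewrite -[_ :: v]cat0s in e2.
    have [w1 [j [w2 [_ _ [_ eb _ _] _]]]] := paint_split e2.
    by case: (b) eb.
  move=> hr hx2 hd /esym e; case: (cat_cons_inv e) => [[v1 e1 e2]|[u2 e' _]]; last first.
    by have [? [? [? [_ _ ? _]]]] := paint_split e'.
  have [q1 [w1 [w2 [[eb _ ex1] [hu elf _ hv]]]]] := forget_split hd e1; subst b'.
  case: v1 e1 e2 hv => [|c1 v1] e1 /=; last first.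
    move=> [ec1 _]; subst c1; rewrite -cat_rcons in e1.
    by have [? [? [? [[]]]]] := forget_split hd e1.
  move=> e2; case: w2 ex1 => // ex1 _; subst x1 lf.
  apply: (@Sweeping_backward _ b w1 (i :: x2) u) => //; first by rewrite -cat_rcons -cats1.
  rewrite [_ :: v]e2 /= (_ : nilp (w1 ++ [:: i]) = false); last by case: (w1).
  by case: (x2) hx2.
Qed.

Lemma sweeping_ready c : sweeping c -> all (fun c : cell => c.1.1.2 == None) c ->
  exists b x, reach x /\ c = paint true true b None x.
Proof.
have d_nil lf rf b y d1 : map forget d1 = paint lf rf b (Some q0) y ->
    all (fun c : cell => c.1.1.2 == None) d1 -> d1 = [::] /\ y = [::].
  by case: d1 y => [|[[[[? ?] [?|]] ?] ?] d1] [|i y].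
case=> [b x1 x2 y1 d1 q hr hx _ hd _ _ ->|b x1 x2 d1 hr _ hd ->]; rewrite all_cat => /andP[h1 _].
  have [d0 y0] := d_nil _ _ _ _ _ hd h1; subst d1 y1.
  by move: (expands_nil hx) hr => ->; exists b, x2.
have [d0 x0] := d_nil _ _ _ _ _ hd h1; subst d1 x1.
by exists (~~ b), x2.
Qed.

(** * The context-sensitive grammar on cells *)

Notation gsym := (option cell + T)%type.

Inductive grammar_rule (nullable : Prop) : seq gsym -> seq gsym -> Prop :=
| Grammar_start : grammar_rule nullable [:: inl None]
    [:: inl (Some (inl (inl S), false, None, true, true))]
| Grammar_null : nullable -> grammar_rule nullable [:: inl None] [::]
| Grammar_cell l r : cell_rule l r ->
    grammar_rule nullable (map (fun c => inl (Some c)) l) (map (fun c => inl (Some c)) r)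
| Grammar_terminal i b lf rf a : terminal_of i = Some a ->
    grammar_rule nullable [:: inl (Some (i, b, None, lf, rf))] [:: inr a].

Notation embed := (map (fun c : cell => inl (Some c) : gsym)).
Notation start := (paint true true false None [:: inl (inl S)]).

(** Terminals may be produced early, while other cells are still being rewritten. Relating each form
    to a cell word from which it arises by such replacements keeps the invariant on cells. *)
Definition decodes (c : cell) (s : gsym) : Prop :=
  s = inl (Some c) \/
  exists i b lf rf a, [/\ c = (i, b, None, lf, rf), terminal_of i = Some a & s = inr a].

Fixpoint decodes_seq (c : seq cell) (s : seq gsym) : Prop :=
  match c, s with
  | [::], [::] => True
  | x :: c', y :: s' => decodes x y /\ decodes_seq c' s'
  | _, _ => False
  end.

Lemma decodes_embed c : decodes_seq c (embed c).
Proof. by elim: c => //= x c IH; split=> //; left. Qed.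

Lemma decodes_embed_inv c l : decodes_seq c (embed l) -> c = l.
Proof.
elim: c l => [|x c IH] [|y l] //= [[[->]|[? [? [? [? [? [_ _ //]]]]]]] /IH ->] //.
Qed.

Lemma decodes_cat c1 c2 s1 s2 : decodes_seq c1 s1 -> decodes_seq c2 s2 ->
  decodes_seq (c1 ++ c2) (s1 ++ s2).
Proof. by elim: c1 s1 => [|x c1 IH] [|y s1] //= [h /IH h1] /h1. Qed.

Lemma decodes_cat_inv c s1 s2 : decodes_seq c (s1 ++ s2) ->
  exists c1 c2, [/\ c = c1 ++ c2, decodes_seq c1 s1 & decodes_seq c2 s2].
Proof.
elim: s1 c => [|y s1 IH] c /=; first by exists [::], c.
case: c => [//|x c] [h /IH [c1 [c2 [-> h1 h2]]]].
by exists (x :: c1), c2.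
Qed.

Lemma decodes_not_start c u v : ~ decodes_seq c (u ++ inl None :: v).
Proof.
move/decodes_cat_inv => [c1 [[|x c2] [_ _ //= [h _]]]].
by case: h => [|[? [? [? [? [? [? ? ?]]]]]]].
Qed.

Definition grammar_invariant (nullable : Prop) (s : seq gsym) : Prop :=
  [\/ s = [:: inl None], s = [::] /\ nullable
    | exists2 c, sweeping c & decodes_seq c s].

Lemma single_split (A : Type) (x y : A) u v : [:: x] = u ++ y :: v -> [/\ u = [::], v = [::] & x = y].
Proof. by case: u => [[-> <-]|z [|? ?]]. Qed.

(** A cell rule needs cells on its whole left-hand side, where form and cell word agree; a terminal
    rule changes the form but not the cell word behind it. *)
Lemma grammar_invariant_step nullable s s' : grammar_invariant nullable s ->
  rewrites (grammar_rule nullable) s s' -> grammar_invariant nullable s'.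
Proof.
move=> hs [u [v [l [r [hlr es ->]]]]]; rewrite {}es in hs.
have lnil : l != [::] by case: hlr => // l' r' [].
case: hs => [e|[e _]|[c hc hd]].
- case: hlr e {lnil} => {l r} [e|hn e|l r hlr e|i b lf rf a hi e].
  + have [-> -> _] := single_split (esym e); apply: Or33.
    exists start; last exact: decodes_embed.
    by apply: (@Sweeping_forward _ false [::] [:: inl (inl S)] [::] [::] q0) => //=; exact: rt_refl.
  + by have [-> -> _] := single_split (esym e); apply: Or32.
  + have [x [l' el]] : exists x l', l = x :: l' by case: hlr => *; do 2!eexists.
    by rewrite el /= in e; have [_ _] := single_split (esym e).
  + by have [_ _] := single_split (esym e).
- by case: u e lnil => //; case: l {hlr}.
- case: hlr hd {lnil} => {l r} [hd|hn hd|l r hlr hd|i b lf rf a hi hd].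
  + by case: (decodes_not_start hd).
  + by case: (decodes_not_start hd).
  + have [c1 [c' [ec h1 /decodes_cat_inv [c2 [c3 [ec' h2 h3]]]]]] := decodes_cat_inv hd.
    move/decodes_embed_inv: h2 => h2; subst c' c2 c; apply: Or33.
    exists (c1 ++ r ++ c3).
      by apply: sweeping_step hc _; exists c1, c3, l, r.
    by apply: decodes_cat => //; apply: decodes_cat => //; exact: decodes_embed.
  + apply: Or33; exists c => //.
    have [c1 [[|c2 c3] [ec h1 //= [h2 h3]]]] := decodes_cat_inv hd.
    rewrite ec; apply: decodes_cat => //; split=> //.
    case: h2 => [[h2]|[? [? [? [? [? [? ? //]]]]]]].
    by right; exists i, b, lf, rf, a; rewrite h2.
Qed.

Lemma decodes_terminal c z : decodes_seq c (map inr z) ->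
  all (fun c : cell => c.1.1.2 == None) c /\
  map (fun c : cell => terminal_of c.1.1.1.1) c = map Some z.
Proof.
elim: c z => [|x c IH] [|a z] //= [[//|[i [b [lf [rf [a' [-> hi [->]]]]]]]] /IH [h1 h2]].
by rewrite h1 h2 /= hi.
Qed.

Lemma paint_items lf rf b s w : map (fun c : cell => c.1.1.1.1) (paint lf rf b s w) = w.
Proof. by elim: w lf => //= i w IH lf; rewrite IH. Qed.

Lemma paint_decodes lf rf b w z : map (@terminal_of N T) w = map Some z ->
  decodes_seq (paint lf rf b None w) (map inr z).
Proof.
elim: w z lf => [|i w IH] [|a z] lf //= [hi /IH h]; split=> //.
by right; exists i, b, lf, (rf && nilp w), a.
Qed.

Lemma decodes_star nullable c s : decodes_seq c s ->
  clos_refl_trans (rewrites (grammar_rule nullable)) (embed c) s.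
Proof.
elim: c s => [|x c IH] [|y s] //=; first by move=> _; exact: rt_refl.
move=> [h /IH h'].
apply: rt_trans (rewrites_star_catl [:: inl (Some x)] h') _.
case: h => [->|[i [b [lf [rf [a [-> hi ->]]]]]]]; first exact: rt_refl.
by apply: rt_step; exists [::], s; do 2!eexists;
  split; first exact: (@Grammar_terminal nullable i b lf rf a hi).
Qed.

Lemma grammar_run nullable z :
  clos_refl_trans (rewrites (grammar_rule nullable)) [:: inl None] (map inr z) <->
  (z = [::] /\ nullable) \/ run_lang P dfa_lang S z.
Proof.
split.
  move=> h; have : grammar_invariant nullable (map inr z).
    elim/clos_refl_trans_ind_left: h => [|x y _]; first exact: Or31.
    exact: grammar_invariant_step.
  case=> [|[hz hn]|[c hc hd]]; first by case: z {h}.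
    by left; split=> //; case: z hz {h}.
  have [h1 h2] := decodes_terminal hd.
  have [b [x [hx ec]]] := sweeping_ready hc h1; subst c.
  right; exists x => //; rewrite -h2 -[in LHS](paint_items true true b None x) -map_comp.
  by [].
case=> [[-> hn]|[y hy hz]].
  by apply: rt_step; exists [::], [::], [:: inl None], [::]; split=> //; exact: Grammar_null.
have [b hb] := reach_cells hy.
apply: (rt_trans _ _ _ (embed start)).
  by apply: rt_step; exists [::], [::]; do 2!eexists; split; first exact: Grammar_start.
apply: rt_trans (rewrites_star_map (Grammar_cell nullable) hb) _.
by apply: decodes_star; exact: paint_decodes.
Qed.

Lemma grammar_rule_ok nullable l r : grammar_rule nullable l r ->
  (exists u v w A, [/\ l = u ++ inl A :: v, r = u ++ w ++ v & w != [::]]) \/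
  [/\ l = [:: inl None], r = [::] & nullable].
Proof.
case=> {l r} [|h|l r hlr|i b lf rf a _]; last 1 first.
- by left; exists [::], [::], [:: inr a], (Some (i, b, None, lf, rf)).
- by left; exists [::], [::], [:: inl (Some (inl (inl S), false, None, true, true))], None.
- by right.
left; case: hlr => {l r} [i b rf w hi _|i0 q lf0 i b rf w hi _|i b q lf|i b q lf i1 rf1].
- exists [::], [::], (embed (paint true rf b (Some (item_next q0 i)) w)), (Some (i, b, None, true, rf)).
  split; rewrite ?cats0 //.
  by move/expand_nonnil: hi; case: (w).
- exists [:: inl (Some (i0, b, Some q, lf0, false))], [::],
    (embed (paint false rf b (Some (item_next q i)) w)), (Some (i, b, None, false, rf)).
  split; rewrite ?cats0 //.
  by move/expand_nonnil: hi; case: (w).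
- by exists [::], [::], [:: inl (Some (i, ~~ b, None, lf, true))], (Some (i, b, Some q, lf, true)).
- by exists [::], [:: inl (Some (i1, ~~ b, None, false, rf1))],
    [:: inl (Some (i, ~~ b, None, lf, false))], (Some (i, b, Some q, lf, false)).
Qed.

Lemma grammar_rule_start nullable l r : grammar_rule nullable l r -> inl None \notin r.
Proof. by case=> // {}l {}r _; elim: r. Qed.

Lemma size_paint lf rf b s w : size (paint lf rf b s w) = size w.
Proof. by elim: w lf => //= i w IH lf; rewrite IH. Qed.

(** The rules are given by a predicate; bounded lengths allow them to be collected in a list. *)
Lemma grammar_rule_bound nullable : exists m, forall l r,
  grammar_rule nullable l r -> size l <= m /\ size r <= m.
Proof.
have [m hm] := rhs_bound P; exists (m + 2) => l r.
have he i w : expand P i w -> size w <= m + 1.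
  case: i => [[A|a]|a]; [|by move=> -> /=; lia|by move=> -> /=; lia].
  by move=> [v [/hm h _ ->]]; rewrite size_map; lia.
case=> {l r} [|h|l r hlr|i b lf rf a _] /=; try lia.
case: hlr => {l r} [i b rf w /he hi _|i0 q lf0 i b rf w /he hi _|i b q lf|i b q lf i1 rf1];
  rewrite /= ?size_map ?size_paint /=; lia.
Qed.

End Sweeps.

(** * Tree-controlled languages with regular control are context-sensitive *)

Lemma exists_rules (X : finType) (rule : seq X -> seq X -> Prop) m :
  (forall l r, rule l r -> size l <= m /\ size r <= m) ->
  exists G : seq (seq X * seq X), forall l r, (l, r) \in G <-> rule l r.
Proof.
move=> hm; have [W hW] := exists_words X m.
have [G hG] := exists_filter [seq (l, r) | l <- W, r <- W] (fun p => rule p.1 p.2).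
exists G => l r; rewrite hG /=; split=> [[]//|h]; split=> //.
by have [/hW hl /hW hr] := hm _ _ h; apply/allpairsP; exists (l, r).
Qed.

Lemma dfa_TC_CS (T : finType) (L : lang T) (N : finType) (P : seq (N * seq (N + T))) S R :
  cf_wf P S -> dfa_recognizable R -> (forall z, L z <-> tc_lang P S R z) -> @CS T L.
Proof.
move=> wfP [Q [q0 [d [F hF]]]] hL.
(* The empty word comes only from the erasing rule, whose tree passes control exactly when the word
   [S] lies in [R]. *)
pose nullable := (S, [::]) \in P /\ R [:: inl S].
have [m hm] := grammar_rule_bound P S q0 d F nullable.
have [G hG] := exists_rules hm.
have hstep x y : cs_step G x y <-> rewrites (grammar_rule P S q0 d F nullable) x y.
  by split=> -[u [v [l [r [/hG h -> ->]]]]]; exists u, v, l, r.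
have hR : R = dfa_lang q0 d F by apply/predeqP.
exists _, G, None; split.
  move=> l r /hG /grammar_rule_ok [h|[-> -> _]]; [by left|right; split=> //; split=> //].
  by move=> l' r' /hG; exact: grammar_rule_start.
move=> z; rewrite hL tc_lang_run // /cs_lang.
have -> : cs_step G = rewrites (grammar_rule P S q0 d F nullable).
  by apply/funext => x; apply/predeqP => y; exact: hstep.
rewrite grammar_run -hR /nullable; split=> [[[-> ? ?]|]|[[-> [? ?]]|]]; auto.
by left.
Qed.

(** * Simulating a context-sensitive grammar by a tree-controlled grammar *)

(* SLT_2 is not contained in SLT_3, since the first and the last window of a word are exempt from I; the control
   language is therefore given by first letters, last letters and adjacent pairs, which puts it in every SLT_k. *)
Section Chains.
Variables (V : finType) (first final : pred V) (next : rel V).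

Definition chain (w : seq V) : bool :=
  if w is x :: w' then [&& first x, final (last x w') & path next x w'] else true.

Lemma chain_nth x0 w : 0 < size w ->
  chain w = [&& first (nth x0 w 0), final (nth x0 w (size w).-1) & sorted next w].
Proof. by case: w => //= x w _; rewrite -last_nth. Qed.

(** As [k] is at least 2, windows contain pairs: the pair at position [i] lies in the first window,
    in the last one, or at the beginning of the inner window at [i]. *)
Lemma chain_SLT_k k : 2 <= k -> SLT_k k (fun w => chain w).
Proof.
move=> k2; split; first by lia.
exists (fun x => size x = k /\ sorted next x /\ forall x0, first (nth x0 x 0)),
       (fun x => size x = k /\ sorted next x),
       (fun x => size x = k /\ sorted next x /\ forall x0, final (nth x0 x k.-1)),
       (fun x => size x <= k - 1 /\ chain x).
split; [by move=> ? []|by move=> ? []|by move=> ? []|by move=> ? []|move=> w].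
case: (ltnP (size w) k) => hk.
  split=> [h|[[]//|[]]]; [by left; split=> //; lia | by lia].
have hw : 0 < size w by lia.
have sz j : j <= size w - k -> size (take k (drop j w)) = k.
  by move=> h; rewrite size_takel // size_drop; lia.
have szd : size (drop (size w - k) w) = k by rewrite size_drop; lia.
split=> [h|[[]|[_ [_ [hB1 hB2]] hI [_ [hE1 hE2]]]]]; last 1 first.
- have [x0 _] : exists x0 : V, True by case: (w) hw => // x; exists x.
  rewrite (chain_nth x0) //; apply/and3P; split.
  + by have := hB2 x0; rewrite nth_take //; lia.
  + by have := hE2 x0; rewrite nth_drop; congr (final (nth _ _ _)); lia.
  + apply/(sortedP x0) => i hi.
    case: (ltnP i.+1 k) => h1.
      have := sortedP x0 hB1 i; rewrite size_takel // !nth_take //; last by lia.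
      exact.
    case: (leqP (size w - k) i) => h2.
      have := sortedP x0 hE1 (i - (size w - k)); rewrite szd !nth_drop.
      rewrite addnS !subnKC //.
      by apply; lia.
    (* Here [i.+1] is at least [k], hence [i] is at least 1 and the window at [i] is an inner
       one. *)
    have [_ hs] := hI i ltac:(lia) ltac:(lia).
    have := sortedP x0 hs 0; rewrite sz; last by lia.
    by rewrite !nth_take ?(ltnW k2) // !nth_drop addn0 addn1; apply; lia.
- right; have hs : sorted next w by case: (w) h => //= x w' /and3P[].
  split=> //.
  + split; first by rewrite size_takel.
    split=> [|x0]; first exact: take_sorted.
    by rewrite nth_take; [move: h; rewrite (chain_nth x0) // => /and3P[] | lia].
  + move=> j h1 h2; split; first by apply: sz; lia.
    by apply: take_sorted; exact: drop_sorted.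
  + split=> //; split=> [|x0]; first exact: drop_sorted.
    rewrite nth_drop (_ : _ + _ = (size w).-1); last by lia.
    by move: h; rewrite (chain_nth x0) // => /and3P[].
- lia.
Qed.

Hypothesis nextE : forall x y, final x -> first y -> next x y.

Lemma chain_cat w1 w2 : chain w1 -> chain w2 -> chain (w1 ++ w2).
Proof.
case: w1 => [//|x w1]; case: w2 => [|y w2]; first by rewrite cats0.
move=> /and3P[h1 h2 h3] /and3P[h4 h5 h6] /=.
by rewrite h1 last_cat /= h5 cat_path h3 /= h6 nextE.
Qed.

End Chains.

(** * Marks and the tree-controlled grammar *)

Section CsToTc.
Variables (N T : finType) (P : seq (seq (N + T) * seq (N + T))) (S : N).
Notation sym := (N + T)%type.
Hypothesis okP : cs_rules_ok P S.
Variable m : nat.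
Hypothesis hm : forall l r, (l, r) \in P -> size r <= m.

(** Bounded sequences make this a finite type, so rules can occur inside nonterminals. Positions go
    up to [m + m], as a left-hand side has two contexts of length at most [m] around one symbol. *)
Notation rule := ({bseq m of sym} * N * {bseq m of sym} * {bseq m of sym})%type.
Notation pos := 'I_(m + m).+1.

Definition lhs (p : rule) : seq sym := let: (u, A, v, w) := p in u ++ inl A :: v.
Definition rhs (p : rule) : seq sym := let: (u, A, v, w) := p in u ++ w ++ v.
Definition is_rule (p : rule) : Prop :=
  (lhs p, rhs p) \in P /\ let: (u, A, v, w) := p in bseqval w != [::].
(* The word that rewriting by [p] puts in place of the symbol at position [i] of [lhs p]. *)
Definition contribution (p : rule) (i : nat) : seq sym :=
  let: (u, A, v, w) := p in if i == size u then bseqval w else [:: nth (inl S) (lhs p) i].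

(** [None] is a fresh axiom. Terminals too have plain copies among the nonterminals, since a real
    terminal ends its branch and could no longer serve as context. *)
Notation nt := (option (sym + rule * pos))%type.
Notation sym' := (nt + T)%type.
Notation plain X := (inl (Some (inl X)) : sym').
Notation mark p i := (inl (Some (inr (p, i))) : sym').

Definition symbol (x : sym') : sym :=
  match x with
  | inl None => inl S
  | inl (Some (inl X)) => X
  | inl (Some (inr (p, i))) => nth (inl S) (lhs p) i
  | inr a => inr a
  end.

Lemma size_lhs p : 0 < size (lhs p) <= (m + m).+1.
Proof.
case: p => [[[u A] v] w] /=; rewrite size_cat /=.
have := size_bseq u; have := size_bseq v; lia.
Qed.

Lemma contributions p :
  flatten [seq contribution p i | i <- iota 0 (size (lhs p))] = rhs p.
Proof.
case: p => [[[u A] v] w]; rewrite /contribution /rhs.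
rewrite /lhs size_cat iotaD map_cat flatten_cat /= add0n eqxx; congr (_ ++ (_ ++ _)).
  rewrite -[RHS](mkseq_nth (inl S)) /mkseq.
  have : all (fun i => i < size u) (iota 0 (size u)) by apply/allP => i; rewrite mem_iota.
  elim: (iota _ _) => //= i s IH /andP[hi /IH ->].
  by rewrite nth_cat hi ltn_eqF.
rewrite -[RHS](mkseq_nth (inl S)) /mkseq -[(size u).+1]addn0 iotaDl -map_comp.
elim: (iota _ _) => //= i s ->.
rewrite (_ : (_ + _ == _) = false); last by lia.
rewrite nth_cat (_ : (_ + _ < _) = false); last by lia.
by rewrite (_ : _ + _ - _ = i.+1) //; lia.
Qed.

Inductive tc_rule : nt -> seq sym' -> Prop :=
| Tc_start : tc_rule None [:: plain (inl S)]
| Tc_null : ([:: inl S], [::]) \in P -> tc_rule None [::]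
| Tc_keep X : tc_rule (Some (inl X)) [:: plain X]
| Tc_mark p (i : pos) : i < size (lhs p) -> tc_rule (Some (inl (symbol (mark p i)))) [:: mark p i]
| Tc_terminal a : tc_rule (Some (inl (inr a))) [:: inr a]
| Tc_apply p (i : pos) : is_rule p ->
    tc_rule (Some (inr (p, i))) [seq plain X | X <- contribution p i].

(** A real terminal can neither begin nor follow anything in a controlled word, so terminals appear
    only on the last level. *)
Definition first_ok (x : sym') : bool :=
  match x with
  | inl (Some (inr (p, i))) => val i == 0
  | inl _ => true
  | inr _ => false
  end.
Definition final_ok (x : sym') : bool :=
  match x with
  | inl (Some (inr (p, i))) => i.+1 == size (lhs p)
  | inl _ => true
  | inr _ => false
  end.
Definition continues (x y : sym') : bool :=
  match x, y with
  | inl (Some (inr (p, i))), inl (Some (inr (q, j))) =>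
      [&& p == q, val j == i.+1 & j < size (lhs p)]
  | _, _ => false
  end.
Definition next_ok x y := final_ok x && first_ok y || continues x y.

Notation control := (chain first_ok final_ok next_ok).

Definition marks (p : rule) (i n : nat) : seq sym' :=
  [seq mark p (inord j : pos) | j <- iota i n].

Inductive blocks : seq sym' -> Prop :=
| Blocks_nil : blocks [::]
| Blocks_start w : blocks w -> blocks (inl None :: w)
| Blocks_plain X w : blocks w -> blocks (plain X :: w)
| Blocks_marks p w : blocks w -> blocks (marks p 0 (size (lhs p)) ++ w).

Lemma marks_path p i n : i + n.+1 = size (lhs p) ->
  path next_ok (mark p (inord i)) (marks p i.+1 n) /\
  final_ok (last (mark p (inord i)) (marks p i.+1 n)).
Proof.
have /andP[_ hp] := size_lhs p.
elim: n i => [|n IH] i h; first by rewrite /= inordK; [split=> //; apply/eqP|]; lia.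
have [h1 h2] := IH i.+1 ltac:(lia); split; last exact: h2.
rewrite /= in h1 *; rewrite h1 andbT /next_ok /= eqxx !inordK ?eqxx /=; try lia.
Qed.

Lemma chain_marks p : control (marks p 0 (size (lhs p))).
Proof.
have /andP[hp _] := size_lhs p; have := @marks_path p 0 (size (lhs p)).-1.
case: (size (lhs p)) hp => //= l _ /(_ erefl) [h1 h2].
by rewrite h1 h2 inordK.
Qed.

Lemma blocks_chain w : blocks w -> control w.
Proof.
have hn x y : final_ok x -> first_ok y -> next_ok x y by rewrite /next_ok => -> ->.
elim=> {w} // [w _ h|X w _ h|p w _ h].
- exact: (@chain_cat _ _ _ _ hn [:: inl None]).
- exact: (@chain_cat _ _ _ _ hn [:: plain X]).
- by apply: chain_cat => //; exact: chain_marks.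
Qed.

Lemma chain_tail x w : control (x :: w) -> (forall y, ~~ continues x y) -> control w.
Proof.
case: w => [//|y w] /= /and3P[_ h /andP[hxy hp]] hc.
by rewrite h hp !andbT; move: hxy; rewrite /next_ok (negPf (hc y)) orbF => /andP[].
Qed.

(** A mark before the end of its left-hand side is not final, so its successor must be the next mark
    of the same rule. *)
Lemma marks_tail p (i : pos) n w : i + n.+1 = size (lhs p) ->
  final_ok (last (mark p i) w) -> path next_ok (mark p i) w ->
  exists2 w2, w = marks p i.+1 n ++ w2 & control w2.
Proof.
elim: n i w => [|n IH] i w h.
  case: w => [|y w] /= hf; first by exists [::].
  move=> /andP[hxy hp]; exists (y :: w) => //; rewrite /chain hf hp /= andbT.
  move: hxy; rewrite /next_ok => /orP[/andP[_ //]|].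
  by case: y {hf hp} => [[[//|[q j]]|//]|//] /= /and3P[_ /eqP-> h']; move: h h'; lia.
case: w => [|y w] /=; first by move=> /eqP; lia.
move=> hf /andP[hxy hp].
have hy : continues (mark p i) y.
  by move: hxy; rewrite /next_ok => /orP[/andP[/= /eqP h'] _|//]; lia.
case: y hf hxy hp hy => [[[//|[q j]]|//]|//] /= hf _ hp /and3P[/eqP hq /eqP hj _]; subst q.
have -> : inord i.+1 = j by apply: val_inj; rewrite /= inordK ?hj // -hj ltn_ord.
have [w2 -> hw2] := IH j w ltac:(lia) hf hp.
by exists w2; rewrite ?hj.
Qed.

Lemma chain_blocks w : control w -> blocks w.
Proof.
elim: {w}(size w) {-2}w (leqnn (size w)) => [|n IH] [|x w] //; try by move=> *; exact: Blocks_nil.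
rewrite /= ltnS => hs hc; case: x hc => [[[X|[p i]]|]|a] hc.
- by apply: Blocks_plain; apply: IH => //; apply: chain_tail hc _; case.
- case/and3P: (hc) => /eqP /= hi hf hp.
  have /andP[hl _] := size_lhs p.
  have [w2 ew hw2] := @marks_tail p i (size (lhs p)).-1 w ltac:(lia) hf hp.
  have -> : mark p i :: w = marks p 0 (size (lhs p)) ++ w2.
    rewrite ew -[in RHS](prednK hl) /= hi; congr (mark p _ :: _).
    by apply: val_inj; rewrite /= inordK.
  apply: Blocks_marks; apply: IH => //; apply: leq_trans hs.
  by rewrite ew size_cat leq_addl.
- by apply: Blocks_start; apply: IH => //; apply: chain_tail hc _; case.
- by [].
Qed.

(** * Runs as sequences of rule applications *)

Definition rule_step (l r : seq sym) : Prop :=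
  exists p, [/\ is_rule p, l = lhs p & r = rhs p].
Notation rule_star := (clos_refl_trans (rewrites rule_step)).

Lemma symbol_marks p : map symbol (marks p 0 (size (lhs p))) = lhs p.
Proof.
rewrite -[RHS](mkseq_nth (inl S)) /mkseq -map_comp; apply/eq_in_map => i.
rewrite mem_iota /= => hi; have /andP[_ h] := size_lhs p.
by rewrite inordK //; lia.
Qed.

Lemma tc_rule_plain X v : tc_rule (Some (inl X)) v -> exists2 x, v = [:: x] & symbol x = X.
Proof.
move E: (Some (inl X)) => A h.
case: h E => // [Y [->]|p i hi [->]|a [->]]; by eexists.
Qed.

Lemma tc_rule_start v : tc_rule None v -> v != [::] -> v = [:: plain (inl S)].
Proof. by move E: None => A h; case: h E. Qed.

Lemma tc_rule_mark p (i : pos) v : tc_rule (Some (inr (p, i))) v ->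
  is_rule p /\ v = [seq plain X | X <- contribution p i].
Proof. by move E: (Some (inr (p, i))) => A h; case: h E => // p' i' hp [-> ->]. Qed.

Lemma contribution_nonnil p i : is_rule p -> contribution p i != [::].
Proof. by case: p => [[[u A] v] w] [_ hw] /=; case: ifP. Qed.

Lemma tc_rule_null A : tc_rule A [::] -> A = None /\ ([:: inl S], [::]) \in P.
Proof.
move E: [::] => v h; case: h E => // p i hp.
by have := contribution_nonnil i hp; case: (contribution p i).
Qed.

Lemma tc_rule_start_rhs A v : tc_rule A v -> inl None \notin v.
Proof. by case=> // p i _; elim: (contribution p i). Qed.

Lemma tc_rule_size A v : tc_rule A v -> size v <= m.+1.
Proof.
case=> //= p i _; rewrite size_map; case: p => [[[u B] v'] w] /=.
by case: ifP => // _; have := size_bseq w; lia.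
Qed.

Lemma exists_tc_rules : exists P' : seq (nt * seq sym'), forall A v, (A, v) \in P' <-> tc_rule A v.
Proof.
have [W hW] := exists_words sym' m.+1.
have [P' hP'] := exists_filter [seq (A, v) | A <- enum {: nt}, v <- W] (fun r => tc_rule r.1 r.2).
exists P' => A v; rewrite hP' /=; split=> [[]//|h]; split=> //.
by apply/allpairsP; exists (A, v); rewrite mem_enum; split=> //; apply/hW; exact: tc_rule_size h.
Qed.

Variable P' : seq (nt * seq sym').
Hypothesis hP' : forall A v, (A, v) \in P' <-> tc_rule A v.

(** Marks can be set for any [p]; that [p] is a rule is checked only when a mark is rewritten,
    whence [0 < n]. *)
Lemma marks_expand p i n y : i + n <= size (lhs p) ->
  expands P' (map inl (marks p i n)) y -> 0 < n ->
  is_rule p /\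
  y = map inl [seq plain X | X <- flatten [seq contribution p j | j <- iota i n]].
Proof.
elim: n i y => [//|n IH] i y h /= [w [y' [[v [/hP' /tc_rule_mark [hp ->] _ ->]] hy ->]]] _.
split=> //; rewrite !map_cat; congr (_ ++ _).
  by rewrite inordK //; have /andP[_ h'] := size_lhs p; lia.
by case: n IH h hy => [_ _ -> //|n IH h hy]; have [|_] := IH i.+1 y' _ hy erefl; first by lia.
Qed.

(** The marked blocks of a level are disjoint, so their simultaneous replacement amounts to applying
    the rules one after the other; all other nodes keep their value under [symbol]. *)
Lemma blocks_step w y : blocks w -> expands P' (map inl w) y ->
  exists2 w', y = map inl w' & rule_star (map symbol w) (map symbol w').
Proof.
move=> hw; elim: hw y => {w} [|w _ IH|X w _ IH|p w _ IH] y.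
- by move=> ->; exists [::] => //; exact: rt_refl.
- move=> [u [y' [[v [/hP' /tc_rule_start h hv ->]] /IH [w' -> hs] ->]]].
  rewrite (h hv); exists (plain (inl S) :: w') => //.
  exact: (rewrites_star_catl [:: inl S] hs).
- move=> [u [y' [[v [/hP' /tc_rule_plain [x -> hx] hv ->]] /IH [w' -> hs] ->]]].
  exists (x :: w') => //=; rewrite hx.
  exact: (rewrites_star_catl [:: X] hs).
- rewrite map_cat => /expands_cat_inv [y1 [y2 [-> hy1 /IH [w' -> hs]]]].
  have /andP[hl _] := size_lhs p.
  have [hp ->] := marks_expand (leqnn _ : 0 + size (lhs p) <= _) hy1 hl.
  rewrite contributions; exists ([seq plain X | X <- rhs p] ++ w'); first by rewrite map_cat.
  rewrite !map_cat symbol_marks -map_comp (eq_map (_ : _ =1 id)) // map_id.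
  apply: rt_trans (rewrites_star_catl _ hs) _.
  by apply: rt_step; exists [::], (map symbol w'), (lhs p), (rhs p); split=> //; exists p.
Qed.

Notation run := (clos_refl_trans (level_step P' (fun w => control w))).

Lemma active_inl (w : seq sym') : active (map inl w) = w.
Proof. by elim: w => //= x w ->. Qed.

Lemma run_rule_star y : run [:: inl (inl None)] y ->
  exists2 w, y = map inl w & rule_star [:: inl S] (map symbol w).
Proof.
move=> h; elim/clos_refl_trans_ind_left: h => [|x z _ [w -> hw] [hc hx]].
  by exists [:: inl None] => //; exact: rt_refl.
rewrite active_inl in hc.
have [w' -> hw'] := blocks_step (chain_blocks hc) hx.
by exists w' => //; exact: rt_trans hw hw'.
Qed.

Notation plains v := [seq plain X | X <- v].

Lemma expands_keep v : expands P' (map inl (plains v)) (map inl (plains v)).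
Proof.
elim: v => [//|X v IH]; exists [:: inl (plain X)], (map inl (plains v)); split=> //.
by exists [:: plain X]; split=> //; apply/hP'; exact: Tc_keep.
Qed.

Lemma expands_mark p i n : i + n <= size (lhs p) ->
  expands P' (map inl (plains (map symbol (marks p i n)))) (map inl (marks p i n)).
Proof.
elim: n i => [//|n IH] i h /=.
exists [:: inl (mark p (inord i))], (map inl (marks p i.+1 n)); split=> //.
  exists [:: mark p (inord i)]; split=> //; apply/hP'; apply: Tc_mark.
  by have /andP[_ h'] := size_lhs p; rewrite inordK; lia.
by apply: IH; lia.
Qed.

Lemma expands_apply p i n : is_rule p -> i + n <= size (lhs p) ->
  expands P' (map inl (marks p i n))
    (map inl (plains (flatten [seq contribution p j | j <- iota i n]))).
Proof.
move=> hp; elim: n i => [//|n IH] i h /=.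
have /andP[_ h'] := size_lhs p.
eexists; eexists; split; last by rewrite !map_cat.
  exists (plains (contribution p i)); split=> //.
    by apply/hP'; rewrite -{2}(@inordK (m + m) i); [exact: Tc_apply | lia].
  by have := contribution_nonnil i hp; case: (contribution p i).
by apply: IH; lia.
Qed.

Lemma blocks_plains v w : blocks w -> blocks (plains v ++ w).
Proof. by move=> hw; elim: v => [//|X v IH]; exact: Blocks_plain. Qed.

(** One rule application takes two steps: the occurrence of the left-hand side is marked, then each
    mark yields its contribution. *)
Lemma rule_step_run x y : rewrites rule_step x y ->
  run (map inl (plains x)) (map inl (plains y)).
Proof.
move=> [u [v [l [r [[p [hp -> ->]] -> ->]]]]]; rewrite !map_cat.
have hb := blocks_plains v Blocks_nil; rewrite cats0 in hb.
apply: (rt_trans _ _ _ (map inl (plains u) ++ map inl (marks p 0 (size (lhs p))) ++ map inl (plains v))).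
  apply: rt_step; split.
    rewrite -!map_cat active_inl; apply: blocks_chain.
    by rewrite -[plains _]cats0; apply: blocks_plains; exact: Blocks_nil.
  apply: expands_cat; first exact: expands_keep.
  apply: expands_cat; last exact: expands_keep.
  by rewrite -{1}symbol_marks; exact: expands_mark.
apply: rt_step; split.
  rewrite -!map_cat active_inl; apply: blocks_chain.
  by apply: blocks_plains; exact: Blocks_marks.
apply: expands_cat; first exact: expands_keep.
apply: expands_cat; last exact: expands_keep.
by rewrite -contributions; exact: expands_apply.
Qed.

Lemma rule_star_run x : rule_star [:: inl S] x ->
  run [:: inl (inl None)] (map inl (plains x)).
Proof.
move=> h; elim/clos_refl_trans_ind_left: h => [|y z _ IH hyz]; last first.
  exact: rt_trans IH (rule_step_run hyz).
apply: rt_step; split=> //=; exists [:: inl (plain (inl S))], [::]; split=> //.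
by exists [:: plain (inl S)]; split=> //; apply/hP'; exact: Tc_start.
Qed.

Lemma run_lang_rule_star z :
  run_lang P' (fun w => control w) None z <-> rule_star [:: inl S] (map inr z).
Proof.
split=> [[y /run_rule_star [w -> hw] hz]|/rule_star_run h].
  suff <- : map symbol w = map inr z by [].
  elim: w z hz {hw} => [|x w IH] [|a z] //= [hx /IH ->].
  by case: x hx => // b [->].
exists (map inl (map inr z)); last by rewrite -!map_comp; apply: eq_map.
(* One more step turns all plain copies of terminals into real ones; the level so reached is not
   controlled. *)
apply: rt_trans h _; apply: rt_step; split.
  rewrite active_inl; apply: blocks_chain.
  by rewrite -[plains _]cats0; apply: blocks_plains; exact: Blocks_nil.
elim: z => [//|a z IH] /=; exists [:: inl (inr a)], (map inl (map inr z)); split=> //.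
by exists [:: inr a]; split=> //; apply/hP'; exact: Tc_terminal.
Qed.

(** * The erasing rule of the context-sensitive grammar *)

Lemma cs_rule_cases l r : (l, r) \in P -> rule_step l r \/
  [/\ l = [:: inl S], r = [::] & ([:: inl S], [::]) \in P].
Proof.
move=> h; case: (okP h) => [[u [v [w [A [el er hw]]]]]|[el [er _]]]; last first.
  by right; rewrite -el -er.
have hs : size u + (size w + size v) <= m by move: (hm h); rewrite er !size_cat.
have hu : size u <= m by lia.
have hv : size v <= m by lia.
have hw' : size w <= m by lia.
left; exists (Bseq hu, A, Bseq hv, Bseq hw'); split=> //; split=> //=.
by rewrite -el -er.
Qed.

Lemma null_rhs l r : ([:: inl S], [::]) \in P -> (l, r) \in P -> inl S \notin r.
Proof.
move=> h; case: (okP h) => [[u [v [w [A [_ e hw]]]]]|[_ [_ hr]] /hr //].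
by case: u w e hw => [|? ?] [|? ?].
Qed.

(** If erasing is allowed, [S] occurs on no right-hand side and hence in no form after the first
    step; so only the initial form can be erased. *)
Lemma cs_star_cases x : clos_refl_trans (cs_step P) [:: inl S] x ->
  (x = [::] /\ ([:: inl S], [::]) \in P) \/
  (rule_star [:: inl S] x /\ (([:: inl S], [::]) \in P -> x = [:: inl S] \/ inl S \notin x)).
Proof.
move=> h; elim/clos_refl_trans_ind_left: h => [|y z _ IH [u [v [l [r [hlr ey ->]]]]]].
  by right; split; [exact: rt_refl | left].
have lnil : l != [::].
  by case: (okP hlr) => [[[|? ?] [? [? [? [-> _ _]]]]]|[-> _]].
case: IH => [[y0 _]|[hy hn]].
  by move: lnil; rewrite -size_eq0; move/(congr1 size): ey; rewrite y0 !size_cat /=; lia.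
case: (cs_rule_cases hlr) => [hr|[el er hnull]].
  right; split; first by apply: rt_trans hy _; apply: rt_step; exists u, v, l, r.
  move=> hnull; right; have hS := null_rhs hnull hlr.
  case: (hn hnull) => [e|]; last first.
    by rewrite ey !mem_cat !negb_or hS => /and3P[-> _ ->].
  rewrite e in ey; case: u l ey lnil {hlr hr} => [|? [|? ?]] [|? l] //= [_].
  by case: l v => [|? ?] [|? ?] //= _ _; rewrite cats0.
left; split=> //; case: (hn hnull) => [e|].
  rewrite e el er in ey *; case: u ey => [|? [|? ?]] //= [].
  by move=> <-.
by rewrite ey el !mem_cat mem_head orbT.
Qed.

Lemma cs_lang_cases z : cs_lang P S z <->
  (z = [::] /\ ([:: inl S], [::]) \in P) \/ rule_star [:: inl S] (map inr z).
Proof.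
split=> [/cs_star_cases [[hz hn]|[h _]]|]; [by left; case: z hz|by right|].
case=> [[-> hn]|h].
  by apply: rt_step; exists [::], [::], [:: inl S], [::].
rewrite /cs_lang; elim: h => {z} [x y [u [v [l [r [[p [[hp _] -> ->]] -> ->]]]]]|x|x y z _ h1 _ h2].
- by apply: rt_step; exists u, v, (lhs p), (rhs p).
- exact: rt_refl.
- exact: rt_trans h1 h2.
Qed.

Lemma tc_cs_lang z : cf_wf P' None /\
  (tc_lang P' None (fun w => control w) z <-> cs_lang P S z).
Proof.
have wfP' : cf_wf P' None.
  move=> A w /hP' h w0; subst w; have [-> _] := tc_rule_null h; split=> // B w' /hP'.
  exact: tc_rule_start_rhs.
split=> //; rewrite tc_lang_run // run_lang_rule_star cs_lang_cases.
split=> [[[-> /hP' /tc_rule_null [_ h] _]|]|[[-> h]|]]; auto.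
by left; split=> //; apply/hP'; exact: Tc_null.
Qed.

End CsToTc.

(** * Equality of the language families *)

Lemma CS_TC_SLT_k (T : finType) (L : lang T) k : 2 <= k -> @CS T L -> @TC (@SLTk_family k) T L.
Proof.
move=> k2 [N [P [S [okP hL]]]].
have [m hm] := rhs_bound P.
have [P' hP'] := exists_tc_rules P S m.
have hc z := tc_cs_lang okP hm hP' z.
exists _, P', None, (fun w => chain (@first_ok N T m) (@final_ok N T m) (@next_ok N T m) w).
split; first by have [] := hc [::].
  exact: chain_SLT_k.
by move=> z; rewrite hL; have [_ ->] := hc z.
Qed.

Theorem mainTheorem1 :
  (forall k : nat, 2 <= k ->
     forall (T : finType) (L : lang T), TC (SLTk_family k) T L <-> CS T L) /\
  (forall (T : finType) (L : lang T), TC SLT_family T L <-> CS T L).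
Proof.
split=> [k k2 T L|T L]; split.
- by case=> N [P [S [R [wfP hR hL]]]]; apply: dfa_TC_CS wfP (SLT_k_dfa hR) hL.
- exact: CS_TC_SLT_k.
- by case=> N [P [S [R [wfP [k hR] hL]]]]; apply: dfa_TC_CS wfP (SLT_k_dfa hR) hL.
- case/(CS_TC_SLT_k (leqnn 2)) => N [P [S [R [wfP hR hL]]]].
  by exists N, P, S, R; split=> //; exists 2.
Qed.
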